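(* Let $n\ge 3$ be an integer and let $G$ be a simple graph. Then $G$ is isomorphic to the wheel $W_n$ if and only if all of the following hold: $$[x]\,da(G;x,y) = ny^{n-2}+ y,\qquad [x^{n}]\,da(G;x,y) = (n+1)y^{n+2},\qquad [x^{n+1}]\,da(G;x,y) = y^{n+4}.$$
   Context: All graphs are finite, simple and have at least one vertex. For a graph $G$, $S\subseteq V(G)$ and $u\in V(G)$, let $\bar S=V(G)\setminus S$, let $\delta_S(u)=|\{v\in S:\{u,v\}\in E(G)\}|$, and let $G[S]$ be the subgraph induced by $S$. The defensive alliance polynomial of $G$ is $$da(G;x,y)=\sum_{S} x^{|S|}\,y^{f_y(S)},\qquad f_y(S)=\min_{u\in S}\bigl(\delta_S(u)-\delta_{\bar S}(u)+|V(G)|\bigr),$$ where the sum runs over all non-empty $S\subseteq V(G)$ such that $G[S]$ is connected (single-vertex graphs are connected). $[x^k]\,da(G;x,y)$ denotes the coefficient of $x^k$ in $da(G;x,y)$, which is a polynomial in $y$. The wheel $W_n$ is the graph join $C_n+K_1$, i.e. the cycle $C_n$ together with one extra vertex adjacent to all vertices of the cycle (so it has $n+1$ vertices). *)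

(* Defs.v *)
From HB Require Import structures.
From mathcomp Require Import all_boot all_order all_algebra.

Set Implicit Arguments.
Unset Strict Implicit.
Unset Printing Implicit Defensive.

Import GRing.Theory.
Local Open Scope ring_scope.

(* The vertex type may be empty; nonemptiness is assumed where needed. *)
Record sgraph := SGraph {
  vertex :> finType;
  adj : rel vertex;
  adj_sym : symmetric adj;
  adj_irr : irreflexive adj
}.

Definition sgraph_iso (G H : sgraph) : Prop :=
  exists2 f : G -> H, bijective f & {mono f : u v / adj u v >-> adj u v}.

Section Induced.
Variables (G : sgraph) (S : {set G}).

Definition induced_adj : rel {u : G | u \in S} :=
  [rel u v | adj (val u) (val v)].

Lemma induced_adj_sym : symmetric induced_adj.
Proof. by move=> u v; exact: adj_sym. Qed.

Lemma induced_adj_irr : irreflexive induced_adj.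
Proof. by move=> u; exact: adj_irr. Qed.

Definition induced : sgraph := SGraph induced_adj_sym induced_adj_irr.
End Induced.

(* Also holds of the graph without vertices. *)
Definition connected (G : sgraph) : bool :=
  [forall u : G, forall v : G, connect (@adj G) u v].

Definition delta (G : sgraph) (S : {set G}) (u : G) : nat :=
  #|[set v in S | adj u v]|.

(* delta (~: S) u < #|G|, so the subtraction never truncates. *)
Definition alliance_value (G : sgraph) (S : {set G}) (u : G) : nat :=
  (delta S u + #|G| - delta (~: S) u)%N.

(* Every value at a vertex of S is below #|G| + #|G|, so this default is only
   returned when S is empty; see fyP. *)
Definition fy (G : sgraph) (S : {set G}) : nat :=
  \big[minn/(#|G| + #|G|)%N]_(u in S) alliance_value S u.

Lemma fyP (G : sgraph) (S : {set G}) : S != set0 ->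
  (exists2 u, u \in S & fy S = alliance_value S u) /\
  (forall u, u \in S -> (fy S <= alliance_value S u)%N).
Proof.
move=> /set0Pn[u0 u0S].
have le_fy u : u \in S -> (fy S <= alliance_value S u)%N.
  move=> uS; rewrite /fy -minEnat.
  exact: (@Order.TotalTheory.bigmin_le_cond _ nat).
split=> //.
have [fyE|//] : fy S = (#|G| + #|G|)%N \/
    exists2 u, u \in S & fy S = alliance_value S u.
  rewrite /fy; elim/big_rec: _ => [|u m uS IH]; first by left.
  by rewrite /minn; case: ifP => _ //; right; exists u.
have := le_fy _ u0S; rewrite fyE leqNgt => /negP[].
apply: leq_ltn_trans (leq_subr _ _) _; rewrite ltn_add2r.
rewrite -cardsT; apply: proper_card; rewrite properT.
by apply/eqP => /setP/(_ u0); rewrite !inE adj_irr andbF.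
Qed.

(* da(G;x,y): the outer variable is x and the inner one is y, so that the
   coefficient of x^k is (da G)`_k. *)
Definition da (G : sgraph) : {poly {poly int}} :=
  \sum_(S : {set G} | (S != set0) && connected (induced S))
     ('X^(fy S))%:P * 'X^#|S|.

Section Complete.
Variable n : nat.

Definition complete_adj : rel 'I_n := [rel i j | i != j].

Lemma complete_adj_sym : symmetric complete_adj.
Proof. by move=> i j; rewrite /complete_adj /= eq_sym. Qed.

Lemma complete_adj_irr : irreflexive complete_adj.
Proof. by move=> i; rewrite /complete_adj /= eqxx. Qed.

Definition complete_graph : sgraph := SGraph complete_adj_sym complete_adj_irr.
End Complete.

Section Cycle.
Variable n : nat.

(* ordS is the successor modulo n; i != j only matters when n = 1. *)
Definition cycle_adj : rel 'I_n :=
  [rel i j | (i != j) && ((j == ordS i) || (i == ordS j))].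

Lemma cycle_adj_sym : symmetric cycle_adj.
Proof. by move=> i j; rewrite /cycle_adj /= eq_sym orbC. Qed.

Lemma cycle_adj_irr : irreflexive cycle_adj.
Proof. by move=> i; rewrite /cycle_adj /= eqxx. Qed.

Definition cycle_graph : sgraph := SGraph cycle_adj_sym cycle_adj_irr.
End Cycle.

Section Join.
Variables G H : sgraph.

Definition join_adj : rel (G + H)%type := fun u v =>
  match u, v with
  | inl a, inl b => adj a b
  | inr a, inr b => adj a b
  | _, _ => true
  end.

Lemma join_adj_sym : symmetric join_adj.
Proof. by move=> [a|a] [b|b] //=; exact: adj_sym. Qed.

Lemma join_adj_irr : irreflexive join_adj.
Proof. by move=> [a|a] /=; exact: adj_irr. Qed.

Definition graph_join : sgraph := SGraph join_adj_sym join_adj_irr.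
End Join.

Definition wheel (n : nat) : sgraph :=
  graph_join (cycle_graph n) (complete_graph 1).

(* Main.v *)
(* The coefficient of x is the sum of y^(|G| - deg u) over the vertices u, so it
   gives the order and the degree sequence: one vertex h is adjacent to all the
   others, and these have degree 3. At y = 1 the coefficient of x^n counts the
   vertices whose removal leaves a connected graph; the value n + 1 says that
   all of them do. In particular G - h is connected and 2-regular, hence a
   cycle. *)

Require Import Defs.
From HB Require Import structures.
From mathcomp Require Import all_boot all_order all_algebra zify.
Import GRing.Theory Num.Theory.
Local Open Scope ring_scope.

Set Implicit Arguments.
Unset Strict Implicit.
Unset Printing Implicit Defensive.

(** * Degrees, alliance values and hubs *)

Definition deg (G : sgraph) (u : G) : nat := #|[set v | adj u v]|.

Lemma deg_ltn (G : sgraph) (u : G) : (deg u < #|G|)%N.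
Proof.
rewrite -cardsT; apply: proper_card; rewrite properT.
by apply/eqP => /setP/(_ u); rewrite !inE adj_irr.
Qed.

(** The neighbours of [u] lie among the other vertices and exhaust them exactly when the
    cardinalities agree. This recognises the hub by its degree. *)
Lemma deg_maxP (G : sgraph) (u : G) :
  reflect (forall v, v != u -> adj u v) (#|G| == (deg u).+1).
Proof.
have sub : [set v | adj u v] \subset ~: [set u].
  by apply/subsetP => v; rewrite !inE; apply: contraTneq => ->; rewrite adj_irr.
have cardC : (#|~: [set u]|.+1 = #|G|)%N by rewrite -(cardsC [set u]) cards1.
rewrite -cardC eqSS eq_sym /deg.
apply: (iffP eqP) => [eq_card v vu | all_adj].
  have /eqP/setP/(_ v) : [set v | adj u v] == ~: [set u].
    by rewrite eqEcard sub eq_card /=.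
  by rewrite !inE vu.
apply/eqP; rewrite eqn_leq subset_leq_card //=; apply: subset_leq_card.
by apply/subsetP => v; rewrite !inE => /all_adj.
Qed.

Lemma alliance_value1 (G : sgraph) (u : G) :
  alliance_value [set u] u = (#|G| - deg u)%N.
Proof.
rewrite /alliance_value /delta.
have -> : [set v in [set u] | adj u v] = set0.
  apply/setP => v; rewrite !inE; apply/andP => -[/eqP->].
  by rewrite adj_irr.
rewrite cards0 add0n; congr (_ - #|pred_of_set _|)%N.
apply/setP => v; rewrite !inE; case: eqP => // ->.
by rewrite adj_irr.
Qed.

Lemma alliance_valueT (G : sgraph) (u : G) :
  alliance_value [set: G] u = (deg u + #|G|)%N.
Proof.
rewrite /alliance_value /delta setCT.
have -> : [set v in set0 | adj u v] = set0 by apply/setP => v; rewrite !inE.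
rewrite cards0 subn0; congr (#|pred_of_set _| + _)%N.
by apply/setP => v; rewrite !inE.
Qed.

(** If [v] is adjacent to the removed vertex [u], that edge leaves the inner count and enters the
    outer one, which lowers the value by 2. *)
Lemma alliance_valueC1 (G : sgraph) (u v : G) :
  alliance_value (~: [set u]) v = (deg v + #|G| - (adj v u).*2)%N.
Proof.
rewrite /alliance_value /delta setCK.
have -> : #|[set w in [set u] | adj v w]| = adj v u.
  case: (boolP (adj v u)) => avu.
    rewrite -[RHS](cards1 u); apply: eq_card => w; rewrite !inE.
    by case: eqP => // ->.
  apply: eq_card0 => w; rewrite !inE.
  by apply/andP => -[/eqP->]; rewrite (negPf avu).
have -> : deg v = (adj v u + #|[set w in ~: [set u] | adj v w]|)%N.
  rewrite /deg (cardsD1 u) inE; congr (_ + #|pred_of_set _|)%N.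
  by apply/setP => w; rewrite !inE.
by lia.
Qed.

Lemma fy_eq (G : sgraph) (S : {set G}) (u : G) (k : nat) :
  u \in S -> alliance_value S u = k ->
  (forall v, v \in S -> (k <= alliance_value S v)%N) -> fy S = k.
Proof.
move=> uS uk le_k; have S0 : S != set0 by apply/set0Pn; exists u.
have [[v vS fyE] fy_le] := fyP S0.
by apply/eqP; rewrite eqn_leq -{1}uk fy_le //= fyE le_k.
Qed.

Lemma fy1 (G : sgraph) (u : G) : fy [set u] = (#|G| - deg u)%N.
Proof.
apply: (fy_eq (set11 u)); first exact: alliance_value1.
by move=> v /set1P ->; rewrite alliance_value1.
Qed.

(** Any two vertices of [S] are joined through [h]. For a singleton the adjacency condition is
    vacuous. *)
Lemma connected_induced_hub (G : sgraph) (S : {set G}) (h : G) :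
  h \in S -> (forall u, u \in S -> u != h -> adj h u) -> connected (induced S).
Proof.
move=> hS hub; pose h' : induced S := exist _ h hS.
have to_h u : connect (@adj (induced S)) u h'.
  case: u => u uS; case: (eqVneq u h) => [uh | uh].
    by have -> : exist _ u uS = h' by apply: val_inj.
  by apply: connect1; rewrite /= /induced_adj /= adj_sym hub.
apply/forallP => u; apply/forallP => v; apply: connect_trans (to_h u) _.
by rewrite (sym_connect_sym (@adj_sym (induced S))) to_h.
Qed.

(** * Coefficients of the polynomial in x *)

Lemma coef_da (G : sgraph) (k : nat) :
  (da G)`_k =
  \sum_(S : {set G} | [&& S != set0, connected (induced S) & #|S| == k])
     'X^(fy S).
Proof.
rewrite /da coef_sum [RHS]big_mkcondr /= big_mkcond [RHS]big_mkcond /=.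
apply: eq_bigr => S _; case: (S != set0) => //=.
case: (connected _) => //=; rewrite coefCM coefXn eq_sym.
by case: eqP; rewrite ?mulr1 ?mulr0.
Qed.

Lemma coef_da1 (G : sgraph) : (da G)`_1 = \sum_(u : G) 'X^(#|G| - deg u).
Proof.
rewrite coef_da (eq_bigl (mem [set [set u] | u in [set: G]])) => [|S] /=.
  rewrite big_imset /= => [|u v _ _ /set1_inj //].
  by apply: eq_big => [u|u _]; rewrite ?inE ?fy1.
apply/and3P/imsetP => [[_ _ /cards1P[u ->]] | [u _ ->]]; first by exists u.
rewrite cards1; split=> //; first by apply/set0Pn; exists u; rewrite set11.
apply: (@connected_induced_hub _ _ u); first exact: set11.
by move=> v /set1P ->; rewrite eqxx.
Qed.

(** On n+1 vertices the sets of size n are the complements of single vertices; [0 < n] keeps them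
    non-empty. *)
Lemma coef_daC1 (G : sgraph) (n : nat) : (0 < n)%N -> #|G| = n.+1 ->
  (da G)`_n =
  \sum_(u : G | connected (induced (~: [set u]))) 'X^(fy (~: [set u])).
Proof.
move=> n0 cardG.
have cardC (S : {set G}) : (#|S| + #|~: S| = n.+1)%N by rewrite cardsC.
rewrite coef_da (eq_bigl (fun S : {set G} =>
  (S \in [set ~: [set u] | u in [set: G]]) && connected (induced S))) => [|S].
  rewrite big_imset_cond /= => [|u v _ _ /setC_inj/set1_inj //].
  by apply: eq_bigl => u; rewrite inE.
rewrite [RHS]andbC [RHS]andbC; case: (connected _); rewrite ?andbF //= andbT.
apply/andP/imsetP => [[_ /eqP cardS] | [u _ ->]].
  have /cards1P[u Su] : #|~: S| == 1 by have := cardC S; lia.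
  by exists u; rewrite // -Su setCK.
have cardu : #|~: [set u]| = n by have := cardC [set u]; rewrite cards1; lia.
by rewrite cardu -card_gt0 cardu.
Qed.

Lemma coef_daT (G : sgraph) : (0 < #|G|)%N ->
  (da G)`_#|G| = if connected (induced [set: G]) then 'X^(fy [set: G]) else 0.
Proof.
move=> G0; rewrite coef_da.
transitivity (\sum_(S : {set G} | (S == setT) && connected (induced S))
  'X^(fy S) : {poly int}); last by rewrite big_mkcondr big_pred1_eq.
apply: eq_bigl => S.
have -> : (S == setT) = (#|S| == #|G|).
  by rewrite eqEcard subsetT cardsT eqn_leq max_card.
rewrite -card_gt0; case: eqP => [->|]; first by rewrite G0 andbT.
by rewrite !andbF.
Qed.

(** * From the structure of a wheel to the coefficients *)

(** The link between the two sides of the equivalence: a description by degrees and connectedness,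
    with [h] as hub, that can be read off the coefficients and still determines the wheel. *)
Definition wheel_like (G : sgraph) (n : nat) (h : G) : Prop :=
  [/\ #|G| = n.+1, deg h = n, forall u, u != h -> deg u = 3%N &
      connected (induced (~: [set h]))].

Lemma wheel_like_coef (G : sgraph) (n : nat) (h : G) : (3 <= n)%N ->
  wheel_like n h ->
  [/\ (da G)`_1 = n%:R * 'X^(n - 2) + 'X,
      (da G)`_n = n.+1%:R * 'X^(n + 2) &
      (da G)`_(n.+1) = 'X^(n + 4)].
Proof.
move=> n3 [cardG degh deg3 conn].
have hub u : u != h -> adj h u by apply/deg_maxP; rewrite cardG degh.
have G0 : (0 < #|G|)%N by rewrite cardG.
have cardC : #|[set~ h]| = n.
  by have := cardsC [set h]; rewrite cards1 cardG; lia.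
have deg_ge3 (u : G) : (3 <= deg u)%N.
  by case: (eqVneq u h) => [->|/deg3 ->]; rewrite ?degh.
have [v vh] : exists v : G, v != h.
  have /card_gt0P[v] : (0 < #|[set~ h]|)%N by rewrite cardC; lia.
  by rewrite !inE; exists v.
split.
(* The hub contributes y^((n+1)-n) = y, each other vertex y^((n+1)-3). *)
- rewrite coef_da1 (bigD1 h) //= addrC degh cardG subSnn expr1; congr (_ + _).
  transitivity (\sum_(u in [set~ h]) 'X^(n - 2) : {poly int}).
    apply: eq_big => [u|u uh]; first by rewrite !inE.
    by rewrite deg3 // subSS.
  by rewrite sumr_const cardC mulr_natl.
- rewrite (coef_daC1 _ cardG); last by lia.
  transitivity (\sum_(u : G) 'X^(n + 2) : {poly int}); last first.
    by rewrite sumr_const cardG mulr_natl.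
  apply: eq_big => [u|u _].
    (* Without [h] the graph is connected by assumption; without another vertex, [h] still dominates
       the rest. *)
    case: (eqVneq u h) => [->|uh]; first exact: conn.
    apply: (@connected_induced_hub _ _ h); last by move=> w _ /hub.
    by rewrite !inE eq_sym.
  congr ('X^_).
  (* The minimum is attained at a rim neighbour [w] of the removed vertex, with value 3 + (n+1) - 2.
     Nothing is smaller, since all degrees are at least 3 and at most one edge is lost. *)
  have [w wh uw] : exists2 w, w != h & adj u w.
    case: (eqVneq u h) => [->|uh]; first by exists v => //; apply: hub.
    have /card_gt0P[w] : (0 < #|[set w | adj u w] :\ h|)%N.
      by have := cardsD1 h [set w | adj u w]; rewrite -/(deg u) deg3 //; lia.
    by rewrite !inE => /andP[]; exists w.
  apply: (@fy_eq _ _ w).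
  + by rewrite !inE; apply: contraTneq uw => ->; rewrite adj_irr.
  + by rewrite alliance_valueC1 adj_sym uw deg3 // cardG; lia.
  + move=> z _; rewrite alliance_valueC1 cardG.
    by have := deg_ge3 z; case: (adj z u); lia.
rewrite -cardG coef_daT //.
have -> : connected (induced [set: G]).
  by apply: (@connected_induced_hub _ _ h); rewrite ?inE // => u _ /hub.
(* A rim vertex has the least degree, which gives 3 + (n+1). *)
congr ('X^_); apply: (@fy_eq _ _ v); first by rewrite inE.
  by rewrite alliance_valueT deg3 // cardG; lia.
move=> z _; rewrite alliance_valueT cardG.
by have := deg_ge3 z; lia.
Qed.

(** * From the coefficients to the structure of a wheel *)

Lemma coef_sum_Xn (I : finType) (P : pred I) (e : I -> nat) (k : nat) :
  (\sum_(i | P i) 'X^(e i) : {poly int})`_k = #|[set i | P i & e i == k]|%:R.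
Proof.
rewrite coef_sum -sum1_card natr_sum big_mkcond [RHS]big_mkcond /=.
apply: eq_bigr => i _; rewrite inE coefXn eq_sym.
by case: (P i); case: eqP.
Qed.

Lemma horner1_sum_Xn (I : finType) (P : pred I) (e : I -> nat) :
  (\sum_(i | P i) 'X^(e i) : {poly int}).[1] = #|[set i | P i]|%:R.
Proof.
rewrite horner_sum -sum1_card natr_sum.
apply: eq_big => [i|i _]; first by rewrite inE.
by rewrite hornerXn expr1n.
Qed.

Lemma coef_wheel_like (G : sgraph) (n : nat) : (3 <= n)%N ->
  (da G)`_1 = n%:R * 'X^(n - 2) + 'X ->
  (da G)`_n = n.+1%:R * 'X^(n + 2) -> exists h : G, wheel_like n h.
Proof.
move=> n3; rewrite coef_da1 => da1 dan.
(* At y = 1 the coefficient of x counts the vertices. *)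
have cardG : #|G| = n.+1.
  have /eqP := congr1 (fun p : {poly int} => p.[1]) da1.
  rewrite horner1_sum_Xn hornerD hornerM hornerXn hornerX expr1n mulr1 hornerMn hornerC.
  by rewrite natr1 eqr_nat => /eqP <-; rewrite -cardsT; apply: eq_card.
(* A vertex of degree d contributes y^(n+1-d). The two terms are added because for n = 3 hub and rim
   have the same degree and all four vertices are counted together. *)
have card_deg d : (d <= n)%N ->
    (#|[set u : G | deg u == d]| = (d == 3) * n + (d == n))%N.
  move=> dn; have /eqP := congr1 (fun p : {poly int} => p`_(n.+1 - d)) da1.
  rewrite coef_sum_Xn mulr_natl coefD coefMn coefXn coefX -mulrnA -natrD eqr_nat.
  have -> : (n.+1 - d == n - 2)%N = (d == 3%N) by lia.
  have -> : (n.+1 - d == 1)%N = (d == n) by lia.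
  move=> /eqP <-; apply: eq_card => u; rewrite !inE cardG /=.
  by have := deg_ltn u; rewrite cardG; lia.
have [h] : exists h : G, h \in [set u : G | deg u == n].
  by apply/card_gt0P; rewrite card_deg // eqxx addn1.
rewrite inE => /eqP degh; exists h; split=> //.
  move=> u uh; have degu : (deg u <= n)%N by have := deg_ltn u; rewrite cardG.
  have : (0 < #|[set v : G | deg v == deg u]|)%N.
    by apply/card_gt0P; exists u; rewrite inE.
  (* A degree other than 3 that occurs must be n; then n differs from 3 and only one vertex has this
     degree, so [u] and [h] cannot both have it. *)
  rewrite card_deg //; have [-> //|d3 /=] := eqVneq (deg u) 3%N.
  have [dun _|] := eqVneq (deg u) n; last by [].
  have : (#|[set u; h]| <= #|[set v : G | deg v == n]|)%N.
    apply: subset_leq_card; apply/subsetP => v; rewrite !inE.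
    by case/orP => /eqP ->; apply/eqP.
  rewrite cards2 uh card_deg // eqxx -dun (negPf d3).
  by lia.
move: dan; rewrite (coef_daC1 _ cardG); last by lia.
move=> /(congr1 (fun p : {poly int} => p.[1]))/eqP.
rewrite horner1_sum_Xn hornerM hornerXn expr1n mulr1 hornerMn hornerC eqr_nat.
rewrite -cardG -cardsT => /eqP card_conn.
have /eqP/setP/(_ h) : [set u : G | connected (induced (~: [set u]))] == setT.
  by rewrite eqEcard subsetT card_conn /=.
by rewrite !inE.
Qed.

(** * Connected 2-regular graphs are cycles *)

Lemma deg_induced (G : sgraph) (S : {set G}) (u : induced S) :
  deg u = delta S (val u).
Proof.
rewrite /deg -(card_imset _ val_inj); apply: eq_card => v; rewrite inE.
apply/imsetP/andP => [[w] | [vS uv]].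
  by rewrite inE => uw ->; split=> //; exact: (valP w).
by exists (exist _ v vS); rewrite ?inE.
Qed.
Lemma deg2_third (G : sgraph) (u a b c : G) : deg u = 2%N ->
  adj u a -> adj u b -> adj u c -> a != b -> (c == a) || (c == b).
Proof.
move=> du ua ub uc ab.
have /eqP/setP/(_ c) : [set a; b] == [set v | adj u v].
  rewrite eqEcard cards2 ab -/(deg u) du leqnn andbT.
  by apply/subsetP => v; rewrite !inE => /orP[] /eqP->.
by rewrite !inE uc.
Qed.

Lemma deg2_other (G : sgraph) (u a : G) : deg u = 2%N ->
  exists2 b, adj u b & b != a.
Proof.
move=> du; have [b] : exists b, b \in [set v | adj u v] :\ a.
  by apply/card_gt0P; have := cardsD1 a [set v | adj u v]; rewrite -/(deg u) du; lia.
by rewrite !inE => /andP[ba ub]; exists b.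
Qed.

(** A path without repetition has at most [#|G|] vertices, so the sizes have a maximum. Tuples of a
    fixed size make the existence of such a path a boolean predicate of that size. *)
Lemma longest_path (G : sgraph) : (0 < #|G|)%N ->
  exists s : seq G, [/\ (0 < size s)%N, uniq s, sorted (@adj G) s &
    forall t : seq G, uniq t -> sorted (@adj G) t -> (size t <= size s)%N].
Proof.
move=> /card_gt0P[x _].
pose P m := [exists t : m.-tuple G, uniq t && sorted (@adj G) t].
have P1 : P 1 by apply/existsP; exists [tuple x].
have leP m : P m -> (m <= #|G|)%N.
  case/existsP => t /andP[ut _].
  by rewrite -(size_tuple t) -(card_uniqP ut) max_card.
have exP : exists m, P m by exists 1.
case: (ex_maxnP exP leP) => m /existsP[t /andP[ut st]] maxm.
exists t; rewrite size_tuple; split=> //; first exact: maxm.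
by move=> t' ut' st'; apply: maxm; apply/existsP; exists (in_tuple t'); rewrite ut'.
Qed.

(** Membership in [A] propagates along a path from [x] to any vertex. *)
Lemma connected_closed (G : sgraph) (A : {pred G}) (x : G) : connected G ->
  x \in A -> (forall u v, u \in A -> adj u v -> v \in A) -> forall u, u \in A.
Proof.
move=> /forallP conn xA clA u; have := forallP (conn x) u.
case/connectP => p pth ->; elim: p x xA pth {conn} => [|y p IH] x xA //=.
by case/andP => /(clA _ _ xA) /IH.
Qed.

(* A longest path contains the neighbours of both its ends. Since an inner vertex
   already has both its neighbours next to it on the path, the last vertex can
   only be joined to the first one. *)
Lemma deg2_cycle (G : sgraph) (n : nat) : (3 <= n)%N -> #|G| = n ->
  connected G -> (forall u : G, deg u = 2%N) ->
  exists2 c : 'I_n -> G, injective c & forall i, adj (c i) (c (ordS i)).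
Proof.
move=> n3 cardG conn deg2.
have [|s [s0 us ps maxs]] := @longest_path G; first by rewrite cardG; lia.
case: s s0 us ps maxs => // x s _ us ps maxs; set p := x :: s in us ps maxs *.
pose y i := nth x p i.
have adj_y i : (i.+1 < size p)%N -> adj (y i) (y i.+1).
  move=> lti; exact: (elimT (sortedP x) ps i lti).
have y_eq i j : (i < size p)%N -> (j < size p)%N -> (y i == y j) = (i == j).
  by move=> *; exact: nth_uniq.
have first_in v : adj (y 0) v -> v \in p.
  move=> av; apply: contraT => vp; have := maxs (v :: p).
  by rewrite cons_uniq vp us [sorted _ _]/= adj_sym av ltnn => /(_ isT ps).
have last_in v : adj (y (size s)) v -> v \in p.
  move=> av; apply: contraT => vp; have := maxs (rcons p v).
  rewrite rcons_uniq vp us size_rcons ltnn => /(_ isT); apply.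
  by move: ps av; rewrite /= rcons_path (last_nth x) => ->.
have mid_in i v : (i.+2 < size p)%N -> adj (y i.+1) v -> (v == y i) || (v == y i.+2).
  move=> lti av; apply: (deg2_third (deg2 (y i.+1))) => //.
  - by rewrite adj_sym adj_y //; lia.
  - by rewrite adj_y.
  by rewrite y_eq //; lia.
(* The vertices of the path are closed under adjacency, by cases on first, inner and last vertex;
   connectedness then makes the path span the graph. *)
have all_in : forall u, u \in p.
  apply: (@connected_closed _ _ x conn); first exact: mem_head.
  move=> u v /(nthP x)[i lti <-]; rewrite -/(y i).
  case: i lti => [_|i lti]; first exact: first_in.
  have [lti2|] := ltnP i.+2 (size p).
    by move/(mid_in _ _ lti2) => /orP[] /eqP->; apply: mem_nth => //; do 2!apply: ltnW.
  move=> sz; have -> : i.+1 = size s by move: lti sz => /=; lia.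
  exact: last_in.
have szp : size p = n.
  by rewrite -cardG -(card_uniqP us); apply: eq_card => u; rewrite all_in inE.
have adj_last : adj (y n.-1) (y 0).
  (* [b] is a neighbour of the last vertex other than its predecessor. If [b] were an inner vertex,
     the last vertex would be next to it on the path, and [b] would be that predecessor after
     all. *)
  have [b ab bn] := deg2_other (y n.-2) (deg2 (y n.-1)).
  have /(nthP x)[j ltj yj] := all_in b; rewrite -/(y j) in yj.
  case: j => [|j] in ltj yj *; first by rewrite yj.
  have jn : j.+1 != n.-1 by apply: contraTneq ab => <-; rewrite yj adj_irr.
  have ltj2 : (j.+2 < size p)%N by move: jn ltj; rewrite szp; lia.
  have := mid_in j (y n.-1) ltj2; rewrite yj adj_sym ab => /(_ isT).
  rewrite !y_eq ?szp; try (move: ltj2; rewrite szp; lia).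
  case/orP => /eqP nj; first by move: ltj2; rewrite szp; lia.
  by move: bn; rewrite -yj (_ : n.-2 = j.+1) ?eqxx //; lia.
exists (fun i : 'I_n => y i) => [i j /eqP|i].
  by rewrite y_eq ?szp // => /eqP/val_inj.
have [lti|gei] := ltnP i.+1 n.
  by rewrite /= modn_small // adj_y ?szp.
rewrite /=; have -> : i = n.-1 :> nat by have := ltn_ord i; lia.
by rewrite prednK ?modnn //; lia.
Qed.

(** * Isomorphism with the wheel *)

(** Successor steps from [c ord0] reach every vertex. For n = 0 surjectivity of [c] makes the graph
    empty. *)
Lemma cycle_connected (G : sgraph) (n : nat) (c : 'I_n -> G) :
  (forall u, exists i, u = c i) -> (forall i, adj (c i) (c (ordS i))) ->
  connected G.
Proof.
case: n c => [|n] c c_onto adj_c.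
  by apply/forallP => u; have [[]] := c_onto u.
have from0 i : connect (@adj G) (c ord0) (c i).
  case: i => i; elim: i => [|i IH] lti.
    by have -> : Ordinal lti = ord0 by apply: val_inj.
  have lti' := ltnW lti; apply: connect_trans (IH lti') _; apply: connect1.
  have -> : Ordinal lti = ordS (Ordinal lti').
    by apply: val_inj; rewrite /= modn_small.
  exact: adj_c.
apply/forallP => u; apply/forallP => v.
have [[i ->] [j ->]] := (c_onto u, c_onto v).
by apply: connect_trans (from0 j); rewrite (sym_connect_sym (@adj_sym G)) from0.
Qed.

Lemma ordS_neq (n : nat) (i : 'I_n) : (1 < n)%N -> ordS i != i.
Proof.
move=> n1; rewrite -val_eqE /=; have := ltn_ord i.
by case: (ltnP i.+1 n) => [/modn_small -> | ]; first lia; move=> ni lti;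
  rewrite (_ : i.+1 = n) ?modnn; lia.
Qed.

(** Ensures that successor and predecessor on the cycle are two different neighbours. *)
Lemma ordSS_neq (n : nat) (i : 'I_n) : (2 < n)%N -> ordS (ordS i) != i.
Proof.
move=> n2; rewrite -val_eqE /= -addn1 modnDml addn1; have := ltn_ord i.
case: (ltnP i.+2 n) => [/modn_small -> | ni lti]; first by lia.
rewrite (_ : i.+2 = (i.+2 - n) + n)%N ?modnDr ?modn_small; lia.
Qed.

Lemma wheel_like_iso (G : sgraph) (n : nat) (h : G) : (3 <= n)%N ->
  wheel_like n h -> sgraph_iso G (wheel n).
Proof.
move=> n3 [cardG degh deg3 conn].
have hub u : u != h -> adj h u by apply/deg_maxP; rewrite cardG degh.
pose R := induced (~: [set h]).
have valR (u : R) : val u != h by have := valP u; rewrite /= !inE.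
(* Deleting [h] takes exactly one neighbour from each remaining vertex. *)
have deg2 (u : R) : deg u = 2%N.
  apply/eqP; rewrite -eqSS -(deg3 _ (valR u)) deg_induced /delta /deg.
  apply/eqP; rewrite [RHS](cardsD1 h) inE adj_sym hub // add1n; congr _.+1.
  by apply: eq_card => v; rewrite !inE.
have cardR : #|R| = n.
  rewrite card_sig; have := cardsC [set h]; rewrite cards1 cardG.
  by rewrite (@eq_card _ _ (mem (~: [set h]))) //; lia.
have [c c_inj adj_c] := deg2_cycle n3 cardR conn deg2.
(* So far [c] only sends cycle edges to edges. There are no chords, because the successor and the
   predecessor already use up the degree 2 of [c i]. *)
have mono_c i j : adj (c i) (c j) = cycle_adj i j.
  have prev : adj (c i) (c (ord_pred i)).
    by rewrite adj_sym -{2}(ord_predK i) adj_c.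
  have prevS : ordS i != ord_pred i.
    by rewrite -(inj_eq (@ordS_inj n)) ord_predK ordSS_neq.
  rewrite /cycle_adj /=; apply/idP/andP => [aij | [_ /orP[] /eqP->]]; last 2 first.
  - exact: adj_c.
  - by rewrite induced_adj_sym; exact: adj_c.
  split; first by apply: contraTneq aij => ->; rewrite induced_adj_irr.
  have := deg2_third (deg2 (c i)) (adj_c i) prev aij.
  rewrite !(inj_eq c_inj) => /(_ prevS) /orP[] /eqP ->; rewrite ?eqxx //.
  by rewrite ord_predK eqxx orbT.
pose g (w : wheel n) : G := match w with inl i => val (c i) | inr _ => h end.
have g_inj : injective g.
  move=> [i|i] [j|j] //= => [/val_inj/c_inj -> //|e|e|_].
  - by case/eqP: (valR (c i)).
  - by case/eqP: (valR (c j)).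
  - by rewrite !ord1.
have g_mono : {mono g : u v / adj u v}.
  move=> [i|i] [j|j] /=.
  - exact: mono_c.
  - by rewrite adj_sym; apply: hub; apply: valR.
  - by apply: hub; apply: valR.
  - by rewrite adj_irr !ord1.
(* Both sides have n+1 vertices, so the embedding [g] of the wheel is bijective; its inverse is the
   isomorphism sought. *)
have [|f gK fK] := inj_card_bij g_inj.
  by rewrite cardG card_sum !card_ord addn1.
by exists f => [|u v]; [exists g | rewrite -g_mono !fK].
Qed.

Lemma iso_wheel_like (G : sgraph) (n : nat) : (3 <= n)%N ->
  sgraph_iso G (wheel n) -> exists h : G, wheel_like n h.
Proof.
move=> n3 [f f_bij f_mono].
have [g fK gK] := f_bij.
have g_mono u v : adj (g u) (g v) = adj u v by rewrite -f_mono !gK.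
have g_inj := can_inj gK.
have g_onto u : exists w, u = g w by exists (f u).
have cardG : #|G| = n.+1.
  by rewrite (bij_eq_card f_bij) card_sum !card_ord addn1.
(* The hub and the rim of the wheel, carried to [G] by the inverse isomorphism. *)
pose h := g (inr ord0); pose c i := g (inl i).
have c_onto u : u != h -> exists i, u = c i.
  have [[i|i] ->] := g_onto u; first by exists i.
  by rewrite ord1 eqxx.
have adj_c i : adj (c i) (c (ordS i)).
  by rewrite g_mono /= /cycle_adj /= eqxx eq_sym ordS_neq //; lia.
have c_neq i : c i != h by rewrite (inj_eq g_inj).
exists h; split=> //.
- apply/eqP; rewrite -eqSS -cardG eq_sym; apply/deg_maxP => v /c_onto[i ->].
  by rewrite g_mono.
- move=> u /c_onto[i ->].
  have prevS : ordS i != ord_pred i.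
    by rewrite -(inj_eq (@ordS_inj n)) ord_predK ordSS_neq.
  (* The neighbourhood of a rim vertex: the hub and its two neighbours on the cycle, all distinct as
     n is at least 3. *)
  transitivity #|[set h; c (ordS i); c (ord_pred i)]|; last first.
    by rewrite -setUA cardsU1 cards2 !inE !(eq_sym h) !(negPf (c_neq _)) !(inj_eq g_inj) prevS.
  apply: eq_card => v; rewrite !inE.
  have [[j|j] ->] := g_onto v; rewrite g_mono !(inj_eq g_inj) /=.
    have -> : (inl j == inl (ord_pred i) :> wheel n) = (i == ordS j).
      by rewrite -[RHS](inj_eq (can_inj (@ord_predK n))) ordSK eq_sym.
    rewrite /cycle_adj /= -[inl j == _]/(j == ordS i).
    case: (eqVneq i j) => //= <-.
    by rewrite eq_sym orbb (negPf (ordS_neq _ _)) //; lia.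
  by rewrite ord1.
- have cR i : c i \in ~: [set h] by rewrite !inE.
  apply: (@cycle_connected (induced (~: [set h])) n (fun i => exist _ (c i) (cR i))).
    case=> u uR; have [|i ui] := c_onto u; first by move: uR; rewrite !inE.
    by exists i; apply: val_inj.
  exact: adj_c.
Qed.

Theorem proposition32 (n : nat) (hn : (3 <= n)%N)
    (G : sgraph) (hG : (0 < #|G|)%N) :
  sgraph_iso G (wheel n) <->
  [/\ (da G)`_1 = n%:R * 'X^(n - 2) + 'X,
      (da G)`_n = n.+1%:R * 'X^(n + 2) &
      (da G)`_(n.+1) = 'X^(n + 4)].
Proof.
split=> [/(iso_wheel_like hn)[h]|[da1 dan _]]; first exact: wheel_like_coef.
have [h] := coef_wheel_like hn da1 dan.
exact: wheel_like_iso.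
Qed.
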